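(* Let $d\ge 1$, let $\mathcal{U}_d\subset\mathbb{C}^{d\times d}$ be the unit sphere of matrices of Frobenius norm $1$, let $\overline{\mathrm{B}}:\mathcal{U}_d\to\mathbb{R}$ be $\overline{\mathrm{B}}(A)=\|\mathrm{diag}(AA^*-A^*A)\|^2$, and let $\overline{\mathscr{F}}:\mathcal{U}_d\times[0,\infty)\to\mathcal{U}_d$ be its negative Riemannian gradient flow. For any non-nilpotent $A_0\in\mathcal{U}_d$, the limit $A_\infty=\lim_{t\to\infty}\overline{\mathscr{F}}(A_0,t)$ exists, is balanced, has Frobenius norm $1$, and has zero entries wherever $A_0$ does. If $A_0$ is real, so is $A_\infty$, and if $A_0$ has all non-negative (real) entries, then so does $A_\infty$.
   Context: $\mathbb{C}^{d\times d}$ is regarded as a real inner product space with $\langle A,B\rangle=\mathrm{Re}\,\mathrm{tr}(B^*A)$; $\|\cdot\|$ is the Frobenius norm, $\|B\|^2=\sum_{i,j}|b_{ij}|^2$. $\mathcal{U}_d=\{A\in\mathbb{C}^{d\times d}:\|A\|=1\}$ has the induced Riemannian metric. $\mathrm{diag}:\mathbb{C}^{d\times d}\to\mathbb{C}^{d\times d}$ is the linear map that sets all off-diagonal entries to zero. A matrix $A$ is called balanced if $\mathrm{diag}(AA^*-A^*A)=0$, i.e. for each $i$ the $i$th row and the $i$th column of $A$ have equal Euclidean norm. The flow $\overline{\mathscr{F}}$ is defined by $\overline{\mathscr{F}}(A_0,0)=A_0$ and $\frac{d}{dt}\overline{\mathscr{F}}(A_0,t)=-\mathrm{grad}\,\overline{\mathrm{B}}(\overline{\mathscr{F}}(A_0,t))$,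 where $\mathrm{grad}$ is the Riemannian gradient on $\mathcal{U}_d$. *)

(* Defs.v *)
From HB Require Import structures.
From mathcomp Require Import all_boot all_order all_algebra.
From mathcomp Require Import complex.
From mathcomp Require Import all_classical all_reals all_analysis.
Set Implicit Arguments.
Unset Strict Implicit.
Unset Printing Implicit Defensive.
Import Order.TTheory GRing.Theory Num.Theory.
Import numFieldNormedType.Exports.
Local Open Scope classical_set_scope.
Local Open Scope complex_scope.
Local Open Scope sesquilinear_scope.
Local Open Scope ring_scope.

Definition re_inner (R : realType) (d : nat) (A B : 'M[R[i]]_d) : R :=
  complex.Re (\tr (B ^t* *m A)).

Definition frob (R : realType) (d : nat) (B : 'M[R[i]]_d) : R :=
  Num.sqrt (\sum_i \sum_j ComplexField.Normc.normc (B i j) ^+ 2).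

Definition diag_part (R : realType) (d : nat) (A : 'M[R[i]]_d) : 'M[R[i]]_d :=
  \matrix_(i, j) (if i == j then A i j else 0).

Definition balanced (R : realType) (d : nat) (A : 'M[R[i]]_d) : Prop :=
  diag_part (A *m A ^t* - A ^t* *m A) = 0.

Definition nilpotent_mx (R : realType) (d : nat) (A : 'M[R[i]]_d) : Prop :=
  exists k : nat, A ^+ k = 0.

Definition unit_sphere (R : realType) (d : nat) : set 'M[R[i]]_d :=
  [set A | frob A = 1].

Definition Bbar (R : realType) (d : nat) (A : 'M[R[i]]_d) : R :=
  frob (diag_part (A *m A ^t* - A ^t* *m A)) ^+ 2.

(* [R[i]] carries no topology in MathComp-Analysis, so convergence and
   differentiability of matrix-valued curves are expressed with the Frobenius
   norm. *)
Definition mx_cvg (R : realType) (d : nat) (c : R -> 'M[R[i]]_d)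
    (F : set_system R) (L : 'M[R[i]]_d) : Prop :=
  frob (c t - L) @[t --> F] --> (0 : R).

(* Derivative relative to the domain [D]; one-sided at an endpoint of [D]. *)
Definition velocity_within (R : realType) (d : nat) (D : set R)
    (c : R -> 'M[R[i]]_d) (t : R) (V : 'M[R[i]]_d) : Prop :=
  mx_cvg (fun h : R => (h^-1)%:C *: (c (t + h) - c t))
    (within [set h | D (t + h)] (0 : R)^') V.

Definition curve_through (R : realType) (d : nat) (S : set 'M[R[i]]_d)
    (A X : 'M[R[i]]_d) (c : R -> 'M[R[i]]_d) : Prop :=
  [/\ forall s, S (c s), c 0 = A & velocity_within setT c 0 X].

Definition tangent (R : realType) (d : nat) (S : set 'M[R[i]]_d)
    (A : 'M[R[i]]_d) : set 'M[R[i]]_d :=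
  [set X | exists c, curve_through S A X c].

(* [G] is the gradient at [A] of [f] restricted to the submanifold [S], for the
   metric induced by [re_inner]: [G] is tangent, and the differential of [f] on
   the tangent vector [X], computed along any curve representing [X], is the
   inner product with [G]. *)
Definition is_riemannian_grad (R : realType) (d : nat) (S : set 'M[R[i]]_d)
    (f : 'M[R[i]]_d -> R) (A G : 'M[R[i]]_d) : Prop :=
  tangent S A G /\
  forall X c, curve_through S A X c ->
    is_derive (0 : R) (1 : R) (fun s : R => f (c s)) (re_inner X G).

(* [Phi : S x [0, +oo) -> S] is the negative gradient flow of [f] on [S];
   values of [Phi] outside [S] x [0, +oo) are irrelevant. *)
Definition is_neg_grad_flow (R : realType) (d : nat) (S : set 'M[R[i]]_d)
    (f : 'M[R[i]]_d -> R) (Phi : 'M[R[i]]_d -> R -> 'M[R[i]]_d) : Prop :=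
  forall A, S A ->
  [/\ Phi A 0 = A,
      forall t, 0 <= t -> S (Phi A t) &
      forall t, 0 <= t -> exists2 G : 'M[R[i]]_d,
        is_riemannian_grad S f (Phi A t) G &
        velocity_within [set s | 0 <= s] (Phi A) t (- G)].

(* Main.v *)
(** The Riemannian gradient of [Bbar] on the sphere has entries
    [4 (h_i - h_j - Bbar) a_ij], with [h_i] the squared norm of row [i] minus
    that of column [i].  Hence the flow is a diagonal scaling,
    [a_ij(t) = exp (x_j - x_i + s) a_ij(0)] with [x_i' = 4 h_i] and
    [s' = 4 Bbar]; this yields the statements on zeros, reality and signs.
    A non-nilpotent [A0] has an eigenvalue [l <> 0], and [exp (s t) * l] is an
    eigenvalue of the flow at time [t], whose entries are bounded by 1; so [s]
    is bounded and [Bbar] takes arbitrarily small values along the flow.  By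
    compactness the moduli [m_ij] have a balanced limit point [p].  As [p] is
    balanced, the relative entropy [- \sum p_ij^2 ln (m_ij / p_ij)] of the flow
    to [p] equals [C - s t]; it dominates half of [\sum (m_ij - p_ij)^2], and it
    decreases to 0 since it does so along a subsequence. *)
Require Import Defs.
From HB Require Import structures.
From mathcomp Require Import all_boot all_order all_algebra.
From mathcomp Require Import complex ring lra.
From mathcomp Require Import all_classical all_reals all_analysis.
Set Implicit Arguments.
Unset Strict Implicit.
Unset Printing Implicit Defensive.
Import Order.TTheory GRing.Theory Num.Theory.
Import numFieldNormedType.Exports.
Local Open Scope classical_set_scope.
Local Open Scope complex_scope.
Local Open Scope ring_scope.

(** * Calculus on the half line [t >= 0] *)

(** The scalar counterpart of [velocity_within] on the half line: a right derivative at [t = 0], an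
    ordinary derivative at [t > 0]. *)
Definition hquot_cvg (R : realType) (f : R -> R) (t l : R) : Prop :=
  (h^-1 * (f (t + h) - f t)) @[h --> within [set h : R | 0 <= t + h] (0 : R)^'] --> l.

(* Precomposing with [`|t|] extends a function on the half line evenly to [R],
   so that one-sided data at 0 gives plain continuity. *)
Lemma hquot_continuous (R : realType) (f l : R -> R) :
  (forall t : R, 0 <= t -> hquot_cvg f t (l t)) -> continuous (fun t : R => f `|t|).
Proof.
move=> fl t0; pose T := `|t0|.
have T0 : 0 <= T by rewrite /T.
have H1 : \forall h \near (0 : R)^', 0 <= T + h ->
    `|l T - h^-1 * (f (T + h) - f T)| < 1.
  have := fl T T0; rewrite /hquot_cvg => /cvgrPdist_lt H0.
  exact: (H0 1 ltr01).
apply/cvgrPdist_lt => e e0.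
have K0 : 0 < `|l T| + 1 by rewrite ltr_pwDr.
have : \forall h \near (0 : R), 0 <= T + h -> `|f T - f (T + h)| < e.
  have : \forall h \near (0 : R), h != 0 -> 0 <= T + h ->
      `|l T - h^-1 * (f (T + h) - f T)| < 1 by exact: H1.
  move=> H2; near=> h => Th.
  have [->|h0] := eqVneq h 0; first by rewrite addr0 subrr normr0.
  have Hq : `|l T - h^-1 * (f (T + h) - f T)| < 1.
    by move: h0 Th; near: h.
  have hq : `|h^-1 * (f (T + h) - f T)| < `|l T| + 1.
    rewrite -[X in `|X|](subKr (l T)); apply: le_lt_trans (ler_normB _ _) _.
    by rewrite ltrD2l.
  rewrite distrC -(mulVKf h0 (f (T + h) - f T)) normrM.
  have hh : `|h| < e / (`|l T| + 1).
    near: h; exact: (@nbhs0_lt R R^o _ (divr_gt0 e0 K0)).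
  rewrite -(mulfVK (lt0r_neq0 K0) e) ltr_pM //.
move=> /nbhs_ballP[d /= d0 Hd].
near=> t; rewrite -/T; have -> : `|t| = T + (`|t| - T) by rewrite addrC subrK.
apply: Hd; last by rewrite addrC subrK.
rewrite -ball_normE /= sub0r normrN; apply: le_lt_trans (ler_dist_dist _ _) _.
near: t; exact: cvgr_distC_lt.
Unshelve. all: by end_near. Qed.

(** For [t > 0] the constraint [0 <= t + h] holds for all small [h], and there [|t + h| = t + h]. *)
Lemma hquot_derive (R : realType) (f : R -> R) (t l : R) :
  0 < t -> hquot_cvg f t l -> is_derive t (1 : R) (fun t : R => f `|t|) l.
Proof.
move=> t0 fl.
have H : h^-1 *: (((fun t : R => f `|t|) \o shift t) (h *: 1) - f `|t|)
    @[h --> (0 : R)^'] --> l.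
  apply: cvg_trans fl; move=> P /=; rewrite /nbhs/= /within /= => HP.
  have : \forall h \near (0 : R)^', 0 <= t + h ->
     P (h^-1 * (f (t + h) - f t)) by exact: HP.
  move=> {}HP.
  have : \forall h \near (0 : R)^', 0 < t + h.
    apply: nbhs_dnbhs; near=> h.
    have : `|h| < t by near: h; exact: (@nbhs0_lt R R^o _ t0).
    by rewrite ltr_norml => /andP[]; rewrite -subr_gt0 opprK addrC.
  move: HP; near_simpl => HP Ht; near=> h.
  have th : 0 < t + h by near: h.
  rewrite /= /GRing.scale /= mulr1 [h + t]addrC !gtr0_norm //.
  move: (ltW th); near: h; exact: HP.
apply: DeriveDef; first by apply/cvg_ex; exists l.
exact: (cvg_lim _ H).
Unshelve. all: by end_near. Qed.

Lemma derive_hquot (R : realType) (f : R -> R) (t l : R) :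
  is_derive t (1 : R) f l -> hquot_cvg f t l.
Proof.
move=> [df vf]; rewrite /hquot_cvg.
have H : h^-1 *: ((f \o shift t) (h *: 1) - f t) @[h --> (0 : R)^'] --> l.
  by rewrite -vf; exact: df.
apply: cvg_within_filter; move: H.
suff -> : (fun h => h^-1 *: ((f \o shift t) (h *: 1) - f t)) =
  (fun h => h^-1 * (f (t + h) - f t)) by [].
by apply/funext => h; rewrite /= /GRing.scale /= mulr1 [h + t]addrC.
Qed.

Lemma primitive_nneg (R : realType) (f : R -> R) : continuous f ->
  exists F : R -> R, [/\ F 0 = 0, continuous F &
    forall t : R, 0 < t -> is_derive t (1 : R) F (f t)].
Proof.
move=> cf; pose mu := @lebesgue_measure R.
(* Starting the integral at -1 makes 0 an interior point, so that the fundamental theorem of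
   calculus also applies at [t = 0]. *)
pose G x := (\int[mu]_(t in `[(-1)%R : R, x]) f t)%R.
have HG (t : R) : 0 <= t -> hquot_cvg (fun x => G x - G 0) t (f t).
  move=> t0; have tu : t < t + 1 by rewrite ltrDl.
  have m1t : -1 < t by apply: lt_le_trans t0; rewrite ltrN10.
  have [] := @continuous_FTC1_closed R f (-1) t (t + 1) tu _ m1t (cf t).
    apply: continuous_compact_integrable; first exact: segment_compact.
    exact: (@continuous_subspaceT _ _ _ f).
  rewrite -/G derive1E => dG vG.
  have dG' : is_derive t (1 : R) G (f t) by apply: DeriveDef.
  apply: derive_hquot; have -> : (fun x => G x - G 0) = G - cst (G 0) by [].
  by apply: is_derive_eq; rewrite subr0.
exists (fun x : R => G `|x| - G 0); split; first by rewrite normr0 subrr.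
  exact: hquot_continuous HG.
by move=> t t0; exact: (hquot_derive t0 (HG t (ltW t0))).
Qed.

Lemma MVT_nneg (R : realType) (f df : R -> R) (a b : R) : 0 <= a -> a <= b ->
  continuous f -> (forall t : R, 0 < t -> is_derive t (1 : R) f (df t)) ->
  exists2 c, 0 <= c & f b - f a = df c * (b - a).
Proof.
move=> a0 ab cf fd.
have [c /=|//|c] := @MVT_segment R f df a b ab.
- rewrite in_itv /= => /andP[ac _]; apply: fd; exact: le_lt_trans ac.
- exact: (@continuous_subspaceT _ _ _ f).
- rewrite in_itv /= => /andP[ac _] H; exists c => //; exact: le_trans ac.
Qed.

(** The product of [u] with the integrating factor [expR (- C)] has zero derivative for [t > 0] and
    is continuous at 0, hence is constant on the half line. *)
Lemma linear_ode (R : realType) (u c C : R -> R) : continuous u ->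
  (forall t : R, 0 < t -> is_derive t (1 : R) u (c t * u t)) ->
  continuous C -> (forall t : R, 0 < t -> is_derive t (1 : R) C (c t)) ->
  forall t : R, 0 <= t -> u t = u 0 * expR (C t - C 0).
Proof.
move=> cu du cC dC t t0.
pose g s := u s * expR (- C s).
have cg : continuous g.
  move=> s; apply: cvgM; first exact: cu.
  apply: (continuous_comp (f := fun s => - C s)); last exact: continuous_expR.
  apply: cvgN; exact: cC.
have dg (s : R) : 0 < s -> is_derive s (1 : R) g 0.
  move=> s0; have := du s s0; have := dC s s0 => ? ?.
  have -> : g = u * (expR \o (- C)) by [].
  apply: is_derive_eq; rewrite /GRing.scale /= fctE; ring.
have [x _] := MVT_nneg (df := cst 0) (lexx 0) t0 cg dg.
rewrite mul0r => /eqP; rewrite subr_eq0 => /eqP; rewrite /g => H.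
by rewrite expRD mulrCA mulrA -mulrA -H mulrC expRN divfK // expR_eq0.
Qed.

(** * Entrywise form of convergence, of velocities and of [Bbar] *)

Section MatrixEntries.
Local Open Scope sesquilinear_scope.
Variables (R : realType) (d : nat).
Implicit Types (A B X Y L : 'M[R[i]]_d) (z : R[i]).
Local Notation normc := ComplexField.Normc.normc.
Local Notation Re := complex.Re.
Local Notation Im := complex.Im.

Lemma sqr_normcE z : normc z ^+ 2 = Re z ^+ 2 + Im z ^+ 2.
Proof. by case: z => a b /=; rewrite sqr_sqrtr // addr_ge0 // sqr_ge0. Qed.

Lemma normc_ge0 z : 0 <= normc z.
Proof. by case: z => a b /=; rewrite sqrtr_ge0. Qed.

Lemma ReM_conj z w : Re (z^*%C * w) = Re w * Re z + Im w * Im z.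
Proof. by case: z w => a b [c e] /=; ring. Qed.

Lemma mulc_conj z : z * z^*%C = (normc z ^+ 2)%:C.
Proof.
rewrite sqr_normcE; case: z => a b; apply/eqP; rewrite eq_complex /=.
by apply/andP; split; apply/eqP; ring.
Qed.

Lemma frob_ge0 A : 0 <= frob A. Proof. exact: sqrtr_ge0. Qed.

Lemma sqr_frob A : frob A ^+ 2 = \sum_i \sum_j normc (A i j) ^+ 2.
Proof. by rewrite sqr_sqrtr //; do 2 (apply: sumr_ge0 => ? _); apply: sqr_ge0. Qed.

Lemma normc_le_frob A i j : normc (A i j) <= frob A.
Proof.
rewrite -(@ler_pXn2r _ 2) ?nnegrE ?normc_ge0 ?frob_ge0 // sqr_frob.
rewrite (bigD1 i) //= (bigD1 j) //= -addrA lerDl addr_ge0 //.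
  by apply: sumr_ge0 => ? _; exact: sqr_ge0.
by do 2 (apply: sumr_ge0 => ? _); exact: sqr_ge0.
Qed.

Lemma Re_le_normc z : `|Re z| <= normc z.
Proof.
rewrite -(@ler_pXn2r _ 2) ?nnegrE ?normc_ge0 // sqr_normcE real_normK ?num_real //.
by rewrite lerDl sqr_ge0.
Qed.

Lemma Im_le_normc z : `|Im z| <= normc z.
Proof.
rewrite -(@ler_pXn2r _ 2) ?nnegrE ?normc_ge0 // sqr_normcE real_normK ?num_real //.
by rewrite lerDr sqr_ge0.
Qed.

Lemma ReB z w : Re (z - w) = Re z - Re w. Proof. by case: z w => a b []. Qed.
Lemma ImB z w : Im (z - w) = Im z - Im w. Proof. by case: z w => a b []. Qed.
Lemma ReZ (r : R) z : Re (r%:C * z) = r * Re z.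
Proof. by case: z => a b /=; ring. Qed.
Lemma ImZ (r : R) z : Im (r%:C * z) = r * Im z.
Proof. by case: z => a b /=; ring. Qed.

(** The Frobenius norm dominates the modulus of each entry, hence its real part; this reduces
    matrix-valued curves to real functions. *)
Lemma mx_cvg_Re (c : R -> 'M[R[i]]_d) (F : set_system R) {FF : Filter F} L i j :
  mx_cvg c F L -> Re (c t i j) @[t --> F] --> Re (L i j).
Proof.
move=> cL; apply/cvgrPdist_le => e e0; near=> t.
rewrite distrC -ReB; apply: le_trans (Re_le_normc _) _.
have := normc_le_frob (c t - L) i j; rewrite !mxE => /le_trans; apply.
apply: le_trans (ler_norm _) _.
by near: t; move/cvgr0_norm_le: cL; apply.
Unshelve. all: by end_near. Qed.

Lemma mx_cvg_Im (c : R -> 'M[R[i]]_d) (F : set_system R) {FF : Filter F} L i j :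
  mx_cvg c F L -> Im (c t i j) @[t --> F] --> Im (L i j).
Proof.
move=> cL; apply/cvgrPdist_le => e e0; near=> t.
rewrite distrC -ImB; apply: le_trans (Im_le_normc _) _.
have := normc_le_frob (c t - L) i j; rewrite !mxE => /le_trans; apply.
apply: le_trans (ler_norm _) _.
by near: t; move/cvgr0_norm_le: cL; apply.
Unshelve. all: by end_near. Qed.

Lemma velocity_hquot_Re (c : R -> 'M[R[i]]_d) (t : R) V i j :
  velocity_within [set s | 0 <= s] c t V ->
  hquot_cvg (fun s => Re (c s i j)) t (Re (V i j)).
Proof.
move=> /(@mx_cvg_Re _ _ _ _ i j); rewrite /hquot_cvg.
by under eq_fun do rewrite !mxE ReZ ReB.
Qed.

Lemma velocity_hquot_Im (c : R -> 'M[R[i]]_d) (t : R) V i j :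
  velocity_within [set s | 0 <= s] c t V ->
  hquot_cvg (fun s => Im (c s i j)) t (Im (V i j)).
Proof.
move=> /(@mx_cvg_Im _ _ _ _ i j); rewrite /hquot_cvg.
by under eq_fun do rewrite !mxE ImZ ImB.
Qed.

Lemma withinT_dnbhs0 : within [set h : R | setT (0 + h)] (0 : R)^' = (0 : R)^'.
Proof.
apply/seteqP; split => P; rewrite /within /=; apply: filterS => h; last by [].
by apply.
Qed.

Lemma velocity_derive_Re (c : R -> 'M[R[i]]_d) V i j :
  velocity_within setT c 0 V ->
  is_derive (0 : R) (1 : R) (fun s => Re (c s i j)) (Re (V i j)).
Proof.
rewrite /velocity_within withinT_dnbhs0 => /(@mx_cvg_Re _ _ _ _ i j) H.
suff H' : h^-1 *: (((fun s => Re (c s i j)) \o shift 0) (h *: 1) - Re (c 0 i j))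
    @[h --> (0 : R)^'] --> Re (V i j).
  apply: DeriveDef; first by apply/cvg_ex; exists (Re (V i j)).
  exact: (cvg_lim _ H').
move: H; under eq_fun do rewrite !mxE ReZ ReB add0r.
by under [in X in _ -> X]eq_fun do rewrite /= /GRing.scale /= mulr1 addr0.
Qed.

Lemma velocity_derive_Im (c : R -> 'M[R[i]]_d) V i j :
  velocity_within setT c 0 V ->
  is_derive (0 : R) (1 : R) (fun s => Im (c s i j)) (Im (V i j)).
Proof.
rewrite /velocity_within withinT_dnbhs0 => /(@mx_cvg_Im _ _ _ _ i j) H.
suff H' : h^-1 *: (((fun s => Im (c s i j)) \o shift 0) (h *: 1) - Im (c 0 i j))
    @[h --> (0 : R)^'] --> Im (V i j).
  apply: DeriveDef; first by apply/cvg_ex; exists (Im (V i j)).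
  exact: (cvg_lim _ H').
move: H; under eq_fun do rewrite !mxE ImZ ImB add0r.
by under [in X in _ -> X]eq_fun do rewrite /= /GRing.scale /= mulr1 addr0.
Qed.

(** The [h_i] of the overview, as a real number; [diag_part_defect] identifies it with a diagonal
    entry of the self-commutator of [A]. *)
Definition defect A i : R :=
  \sum_j (normc (A i j) ^+ 2 - normc (A j i) ^+ 2).

Lemma diag_part_defect A :
  diag_part (A *m A ^t* - A ^t* *m A) = diag_mx (\row_i (defect A i)%:C).
Proof.
apply/matrixP => i j; rewrite !mxE; case: eqVneq => [<-|_] /=; last by rewrite mulr0n.
rewrite mulr1n /defect [RHS]raddf_sum /=.
transitivity (\sum_k (A i k * (A ^t*) k i - (A ^t*) i k * A k i)).
  by rewrite sumrB.
apply: eq_bigr => k _.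
by rewrite !mxE rmorphB /= -!mulc_conj; congr (_ - _); rewrite mulrC.
Qed.

Lemma balanced_defect A : balanced A <-> forall i, defect A i = 0.
Proof.
rewrite /balanced diag_part_defect; split=> [H i|H].
  have /matrixP/(_ i i) := H; rewrite !mxE eqxx mulr1n.
  by move=> /complexI.
by apply/matrixP => i j; rewrite !mxE H mul0rn.
Qed.

Lemma Bbar_defect A : Bbar A = \sum_i defect A i ^+ 2.
Proof.
rewrite /Bbar diag_part_defect sqr_frob; apply: eq_bigr => i _.
rewrite (bigD1 i) //= big1 ?addr0 => [|j ji].
  by rewrite !mxE eqxx mulr1n sqr_normcE /= expr0n addr0.
by rewrite !mxE eq_sym (negbTE ji) mulr0n ComplexField.Normc.normc0 expr0n.
Qed.

Lemma re_innerE X Y : re_inner X Y =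
  \sum_i \sum_j (Re (X i j) * Re (Y i j) + Im (X i j) * Im (Y i j)).
Proof.
rewrite /re_inner /mxtrace exchange_big /=.
(* [Rcomplex R] is [R[i]] as a real vector space; [Re] is linear on it and so commutes with sums. *)
have ReS := raddf_sum (@complex.Re R : Rcomplex R -> R).
rewrite [LHS]ReS; apply: eq_bigr => j _.
rewrite mxE [LHS]ReS; apply: eq_bigr => i _.
by rewrite !mxE -ReM_conj.
Qed.

End MatrixEntries.

(** * Riemannian gradient of [Bbar] on the unit sphere *)

Section Gradient.
Variables (R : realType) (d : nat).
Implicit Types (A G X Y Z : 'M[R[i]]_d).
Local Notation normc := ComplexField.Normc.normc.
Local Notation Re := complex.Re.
Local Notation Im := complex.Im.

Lemma re_innerBl X Y Z : re_inner (X - Y) Z = re_inner X Z - re_inner Y Z.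
Proof.
rewrite !re_innerE -sumrB; apply: eq_bigr => i _; rewrite -sumrB.
apply: eq_bigr => j _; rewrite !mxE ReB ImB; ring.
Qed.

Lemma re_innerBr X Y Z : re_inner Z (X - Y) = re_inner Z X - re_inner Z Y.
Proof.
rewrite !re_innerE -sumrB; apply: eq_bigr => i _; rewrite -sumrB.
apply: eq_bigr => j _; rewrite !mxE ReB ImB; ring.
Qed.

Lemma re_inner_self X : re_inner X X = frob X ^+ 2.
Proof.
rewrite re_innerE sqr_frob; apply: eq_bigr => i _; apply: eq_bigr => j _.
by rewrite sqr_normcE !expr2.
Qed.

Lemma frob_eq0 X : frob X = 0 -> X = 0.
Proof.
move=> X0; apply/matrixP => i j; rewrite mxE.
apply: ComplexField.Normc.eq0_normc; apply/eqP; rewrite eq_le normc_ge0 andbT.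
by rewrite -X0 normc_le_frob.
Qed.

Lemma frobZ (r : R) X : frob (r%:C *: X) = `|r| * frob X.
Proof.
rewrite /frob -[`|r|]sqrtr_sqr -sqrtrM ?sqr_ge0 // mulr_sumr; congr Num.sqrt.
apply: eq_bigr => i _; rewrite mulr_sumr; apply: eq_bigr => j _.
by rewrite mxE !sqr_normcE ReZ ImZ; ring.
Qed.

(** Pythagoras: the cross term is [2 * s * re_inner X A], which vanishes. *)
Lemma sqr_frobD_scale A X (s : R) : re_inner X A = 0 ->
  frob (A + s%:C *: X) ^+ 2 = frob A ^+ 2 + s ^+ 2 * frob X ^+ 2.
Proof.
move=> XA; rewrite -[RHS]addr0 -(mulr0 (2 * s)) -XA re_innerE !sqr_frob.
rewrite !mulr_sumr -!big_split; apply: eq_bigr => i _ /=.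
rewrite !mulr_sumr -!big_split; apply: eq_bigr => j _ /=.
rewrite !mxE !sqr_normcE; move: (A i j) (X i j) => [a b] [x y] /=; ring.
Qed.

(** The line [A + s X] is projected radially to the sphere. Its norm [w s] differs from 1 only to
    second order in [s], so the projection keeps the velocity [X] at 0. *)
Lemma sphere_curve A X : frob A = 1 -> re_inner X A = 0 ->
  exists c, curve_through (@unit_sphere R d) A X c.
Proof.
move=> A1 XA; pose n := frob X ^+ 2.
pose w (s : R) := Num.sqrt (1 + s ^+ 2 * n).
have n0 : 0 <= n by exact: sqr_ge0.
have w1 (s : R) : 1 <= w s.
  by rewrite -{1}[1]sqrtr1 ler_wsqrtr // lerDl mulr_ge0 // sqr_ge0.
have w0 r : w r != 0 by apply: lt0r_neq0; exact: lt_le_trans ltr01 (w1 r).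
have frobw s : frob (A + s%:C *: X) = w s.
  by rewrite /w -[1](expr1n _ 2) -A1 -sqr_frobD_scale // sqrtr_sqr ger0_norm ?frob_ge0.
pose c s := ((w s)^-1)%:C *: (A + s%:C *: X).
have c0 : c 0 = A.
  by rewrite /c /w expr0n mul0r addr0 sqrtr1 invr1 scale1r scale0r addr0.
exists c; split => //.
  move=> s; rewrite /unit_sphere /= frobZ frobw ger0_norm ?mulVf //.
  by rewrite invr_ge0 (le_trans ler01).
rewrite /velocity_within withinT_dnbhs0 /mx_cvg.
(* The error is [h^-1 (1 / w h - 1)] times a vector of norm [w h], so its norm is [(w h - 1) / |h|];
   as [w h >= 1], one has [w h - 1 <= (w h)^2 - 1 = n h^2]. *)
have bnd h : h != 0 -> frob ((h^-1)%:C *: (c (0 + h) - c 0) - X) <= n * `|h|.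
  move=> h0; rewrite add0r c0.
  have -> : (h^-1)%:C *: (c h - A) - X =
      (h^-1 * ((w h)^-1 - 1))%:C *: (A + h%:C *: X).
    apply/matrixP => i j; rewrite !mxE.
    rewrite rmorphM rmorphB /= rmorph1 !fmorphV /=.
    have hC : h%:C != 0 by rewrite fmorph_eq0.
    have alg (F : fieldType) (a x y z : F) : y != 0 ->
        y^-1 * (z * (a + y * x) - a) - x = y^-1 * (z - 1) * (a + y * x).
      by move=> y0; field.
    exact: alg.
  rewrite frobZ frobw normrM -mulrA.
  have -> : `|(w h)^-1 - 1| * w h = w h - 1.
    rewrite ler0_norm ?subr_le0 ?invf_le1 ?(lt_le_trans ltr01) //.
    by rewrite opprB mulrBl mulVf // mul1r.
  rewrite normfV mulrC ler_pdivrMr ?normr_gt0 // -mulrA -expr2 real_normK ?num_real //.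
  have := w1 h; have : w h ^+ 2 = 1 + h ^+ 2 * n.
    by rewrite sqr_sqrtr // addr_ge0 // mulr_ge0 // sqr_ge0.
  have := sqr_ge0 h; nra.
(* [n + 1] rather than [n] keeps the divisor positive when [X = 0]. *)
have K0 : 0 < n + 1 by rewrite ltr_wpDl.
apply/cvgr0Pnorm_le => e e0; near=> h.
have h0 : h != 0 by near: h; exact: nbhs_dnbhs_neq.
rewrite ger0_norm ?frob_ge0 //; apply: le_trans (bnd h h0) _.
have : `|h| < e / (n + 1).
  near: h; apply: nbhs_dnbhs; exact: (@nbhs0_lt R R^o _ (divr_gt0 e0 K0)).
rewrite ltr_pdivlMr // => He; apply: le_trans (ltW He); rewrite mulrC.
by rewrite ler_wpM2l // lerDl.
Unshelve. all: by end_near. Qed.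

Lemma is_derive_bigsum n (h : 'I_n -> R -> R) (dh : 'I_n -> R) (x : R) :
  (forall i, is_derive x (1 : R) (h i) (dh i)) ->
  is_derive x (1 : R) (fun s => \sum_(i < n) h i s) (\sum_(i < n) dh i).
Proof.
move=> H; have -> : (fun s => \sum_(i < n) h i s) = \sum_(i < n) h i.
  by apply/funext => s; rewrite fct_sumE.
exact: is_derive_sum.
Qed.

(** The share of entry [(i, j)] in [re_inner X A]; it is half the derivative of the squared modulus
    of that entry along the velocity [X]. *)
Definition ip X A i j := Re (X i j) * Re (A i j) + Im (X i j) * Im (A i j).

Lemma is_derive_sqr_normc (c : R -> 'M[R[i]]_d) X i j :
  velocity_within setT c 0 X ->
  is_derive (0 : R) (1 : R) (fun s => normc (c s i j) ^+ 2) (2 * ip X (c 0) i j).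
Proof.
move=> cX; have := velocity_derive_Re i j cX; have := velocity_derive_Im i j cX.
set u := fun r => Im (c r i j); set v := fun r => Re (c r i j) => dv du.
have -> : (fun s => normc (c s i j) ^+ 2) = v ^+ 2 + u ^+ 2.
  by apply/funext => s; rewrite sqr_normcE.
by apply: is_derive_eq; rewrite /ip /GRing.scale /= /u /v; ring.
Qed.

(** Differentiating the constant squared norm of a curve on the sphere gives
    [2 * re_inner X A = 0]. *)
Lemma sphere_tangent A X : tangent (@unit_sphere R d) A X -> re_inner X A = 0.
Proof.
move=> [c [cS cA cX]].
have D : is_derive (0 : R) (1 : R) (fun s => \sum_i \sum_j normc (c s i j) ^+ 2)
    (\sum_i \sum_j 2 * ip X (c 0) i j).
  by do 2 (apply: is_derive_bigsum => ?); exact: is_derive_sqr_normc.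
have E : (fun s => \sum_i \sum_j normc (c s i j) ^+ 2) = cst 1.
  by apply/funext => s; rewrite -sqr_frob (cS s) expr1n.
rewrite E in D; have [_] := D; rewrite derive_cst cA => /esym.
under eq_bigr do rewrite -mulr_sumr.
by rewrite -mulr_sumr re_innerE => /eqP; rewrite mulf_eq0 pnatr_eq0 => /eqP.
Qed.

(** Summation by parts: differences of [h] are adjoint to row sum minus column sum. It serves both
    the gradient of [Bbar] and the entropy argument. *)
Lemma sum_sub_swap (h : 'I_d -> R) (F : 'I_d -> 'I_d -> R) :
  \sum_i \sum_j (h i - h j) * F i j = \sum_i h i * \sum_j (F i j - F j i).
Proof.
transitivity (\sum_i \sum_j h i * F i j - \sum_i \sum_j h j * F i j).
  rewrite -sumrB; apply: eq_bigr => i _; rewrite -sumrB.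
  by apply: eq_bigr => j _; rewrite mulrBl.
rewrite [X in _ - X]exchange_big -sumrB; apply: eq_bigr => i _ /=.
by rewrite mulr_sumr -sumrB; apply: eq_bigr => j _; rewrite mulrBr.
Qed.

(** The part [4 (h_i - h_j) a_ij] is the Euclidean gradient; on the sphere its inner product with
    [A] is [4 Bbar A], and the last term subtracts this radial component. *)
Definition sphere_grad A : 'M[R[i]]_d :=
  \matrix_(i, j) ((4 * (defect A i - defect A j - Bbar A))%:C * A i j).

Lemma re_inner_sphere_grad A X : re_inner X (sphere_grad A) =
  4 * (\sum_i defect A i * \sum_j (ip X A i j - ip X A j i)) -
  4 * Bbar A * re_inner X A.
Proof.
rewrite -sum_sub_swap !re_innerE !mulr_sumr -sumrB; apply: eq_bigr => i _.
rewrite !mulr_sumr -sumrB; apply: eq_bigr => j _.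
rewrite mxE ReZ ImZ /ip; ring.
Qed.

Lemma sphere_grad_tangent A : frob A = 1 -> re_inner (sphere_grad A) A = 0.
Proof.
move=> A1.
have -> : re_inner (sphere_grad A) A = re_inner A (sphere_grad A).
  by rewrite !re_innerE; do 2 (apply: eq_bigr => ? _); ring.
rewrite re_inner_sphere_grad re_inner_self A1 expr1n mulr1 -mulrBr Bbar_defect.
rewrite -sumrB big1 ?mulr0 // => i _.
rewrite expr2 -mulrBr; have -> : \sum_j (ip A A i j - ip A A j i) = defect A i.
  by apply: eq_bigr => j _; rewrite /ip !sqr_normcE !expr2.
by rewrite subrr mulr0.
Qed.

Lemma is_derive_Bbar A X c : curve_through (@unit_sphere R d) A X c ->
  is_derive (0 : R) (1 : R) (fun s => Bbar (c s)) (re_inner X (sphere_grad A)).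
Proof.
move=> cAX; have [cS cA cX] := cAX.
(* Tangency of [X] kills the radial term; what is left is the chain rule for the sum of squared
   defects. *)
rewrite re_inner_sphere_grad (sphere_tangent (ex_intro _ c cAX)) mulr0 subr0.
have -> : (fun s => Bbar (c s)) = (fun s => \sum_i defect (c s) i ^+ 2).
  by apply/funext => s; rewrite Bbar_defect.
rewrite mulr_sumr -cA; apply: is_derive_bigsum => i.
have D : is_derive (0 : R) (1 : R) (fun s => defect (c s) i)
    (\sum_j (2 * ip X (c 0) i j - 2 * ip X (c 0) j i)).
  apply: is_derive_bigsum => j.
  have := is_derive_sqr_normc i j cX; have := is_derive_sqr_normc j i cX => ? ?.
  exact: is_deriveB.
have -> : (fun s => defect (c s) i ^+ 2) = (fun s => defect (c s) i) ^+ 2 by [].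
apply: is_derive_eq; rewrite /GRing.scale /=.
under eq_bigr do rewrite -mulrBr.
rewrite -mulr_sumr expr1; ring.
Qed.

(** The difference [X] of the two candidates is orthogonal to [A], hence is the velocity of a curve
    on the sphere; both represent the derivative of [Bbar] along it, so [frob X ^+ 2 = 0]. *)
Lemma riemannian_grad_BbarE A G : frob A = 1 ->
  is_riemannian_grad (@unit_sphere R d) (@Bbar R d) A G -> G = sphere_grad A.
Proof.
move=> A1 [/sphere_tangent GA dG]; pose X := G - sphere_grad A.
have XA : re_inner X A = 0 by rewrite re_innerBl GA sphere_grad_tangent // subrr.
have [c cAX] := sphere_curve A1 XA.
have [_ EB] := is_derive_Bbar cAX; have [_ EG] := dG X c cAX.
have : frob X ^+ 2 = 0 by rewrite -re_inner_self re_innerBr -EG EB subrr.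
move=> /eqP; rewrite expf_eq0 /= => /eqP /frob_eq0.
by move=> /eqP; rewrite subr_eq0 => /eqP.
Qed.

End Gradient.

(** * Eigenvalues and the bound on the scaling exponent *)

Section Spectral.
Variable R : realType.
Local Notation normc := ComplexField.Normc.normc.

(** The characteristic polynomial splits over [R[i]]. If all its roots were 0 it would be a power of
    ['X], and Cayley-Hamilton would make [A] nilpotent. *)
Lemma non_nilpotent_eigenvalue n (A : 'M[R[i]]_n.+1) : ~ nilpotent_mx A ->
  exists2 l : R[i], l != 0 & eigenvalue A l.
Proof.
move=> nil; have [r] := closed_field_poly_normal (char_poly A).
rewrite (eqP (char_poly_monic A)) scale1r => Er.
have [r0|] := boolP (all (pred1 0) r); last first.
  move=> /allPn[l lr l0]; exists l => //.
  by rewrite eigenvalue_root_char Er root_prod_XsubC.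
case: nil; exists (size r); rewrite -[A](horner_mx_X A) -rmorphXn /=.
suff -> : 'X^(size r) = char_poly A by exact: Cayley_Hamilton.
rewrite Er; elim: r r0 {Er} => [|z r IH] /=; first by rewrite big_nil expr0.
by move=> /andP[/eqP -> /IH E]; rewrite big_cons -E subr0 exprS.
Qed.

Lemma normc_sum_le n (F : 'I_n -> R[i]) : normc (\sum_i F i) <= \sum_i normc (F i).
Proof.
elim/big_ind2 : _ => [|x a y b xa yb|//]; first by rewrite ComplexField.Normc.normc0.
by apply: le_trans (le_normcD _ _) _; exact: lerD.
Qed.

(** The eigenvector equation is read at a coordinate of [w] of largest modulus: it is a sum of
    [n.+1] terms, none larger in modulus than that coordinate. *)
Lemma eigenvalue_entry_bound n (M : 'M[R[i]]_n.+1) (w : 'rV[R[i]]_n.+1) (mu : R[i]) :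
  w != 0 -> w *m M = mu *: w -> (forall i j, normc (M i j) <= 1) ->
  normc mu <= n.+1%:R.
Proof.
move=> w0 wM M1.
pose k := [arg max_(i > ord0) normc (w ord0 i)]%O.
have kmax i : normc (w ord0 i) <= normc (w ord0 k).
  by rewrite /k; case: arg_maxP => // j _; apply.
have wk : 0 < normc (w ord0 k).
  rewrite lt_def normc_ge0 andbT; apply: contra w0 => /eqP wk0.
  apply/eqP/rowP => i; rewrite mxE; apply: ComplexField.Normc.eq0_normc.
  by apply/eqP; rewrite eq_le normc_ge0 andbT -wk0.
have /matrixP/(_ ord0 k) := wM; rewrite !mxE => E.
rewrite -(ler_pM2r wk) -ComplexField.Normc.normcM -E.
apply: le_trans (normc_sum_le _) _.
apply: (@le_trans _ _ (\sum_(i < n.+1) normc (w ord0 k))).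
  apply: ler_sum => i _; rewrite ComplexField.Normc.normcM -[leRHS]mulr1.
  by apply: ler_pM => //; exact: normc_ge0.
by rewrite sumr_const card_ord mulr_natl.
Qed.

Lemma normcR (r : R) : normc r%:C = `|r|.
Proof. by rewrite /= expr0n /= addr0 sqrtr_sqr. Qed.

(** With [D] the diagonal matrix of the [expR (x j)], the scaled matrix is [expR s] times
    [D^-1 A D]. A row eigenvector [v] of [A] for [l] gives the eigenvector [v D] for [expR s * l],
    so the bound does not depend on [x]. *)
Lemma scaling_bound d (A : 'M[R[i]]_d) : (1 <= d)%N -> ~ nilpotent_mx A ->
  exists K : R, forall (x : 'I_d -> R) (s : R),
    (forall i j, normc ((expR (x j - x i + s))%:C * A i j) <= 1) -> s <= K.
Proof.
case: d A => // n A _ /non_nilpotent_eigenvalue[l l0 /eigenvalueP[v vA v0]].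
have l1 : 0 < normc l.
  rewrite lt_def normc_ge0 andbT; apply: contra l0 => /eqP.
  by move=> /ComplexField.Normc.eq0_normc ->.
exists (ln (n.+1%:R / normc l)) => x s M1.
pose M := \matrix_(i, j) ((expR (x j - x i + s))%:C * A i j).
pose w := \row_j (v ord0 j * (expR (x j))%:C).
have wM : w *m M = (l * (expR s)%:C) *: w.
  apply/rowP => j; have /matrixP/(_ ord0 j) := vA; rewrite !mxE => E.
  rewrite mulrACA -mulrA [_ * (expR (x j))%:C]mulrC.
  rewrite [RHS](_ : _ = (l * v ord0 j) * (expR (s + x j))%:C); last first.
    by rewrite expRD rmorphM /=; ring.
  rewrite -E mulr_suml; apply: eq_bigr => i _; rewrite !mxE.
  have -> : s + x j = x i + (x j - x i + s) by ring.
  by rewrite [expR (x i + _)]expRD rmorphM /=; ring.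
have w0 : w != 0.
  apply: contra v0 => /eqP w0; apply/eqP/rowP => j.
  have /matrixP/(_ ord0 j) := w0; rewrite !mxE => /eqP.
  by rewrite mulf_eq0 fmorph_eq0 (gt_eqF (expR_gt0 _)) orbF => /eqP.
have := eigenvalue_entry_bound w0 wM.
move=> /(_ _)/wrap[i j|]; first by rewrite mxE.
rewrite ComplexField.Normc.normcM normcR gtr0_norm ?expR_gt0 // => H.
rewrite -[s]expRK ler_ln ?posrE ?expR_gt0 ?divr_gt0 ?ltr0n //.
by rewrite ler_pdivlMr // mulrC.
Qed.

End Spectral.

(** * Limits along filters and an entropy inequality *)

(** By compactness the image ultrafilter has a cluster point, and an ultrafilter converges to each
    of its cluster points. *)
Lemma ultra_cvg_itv (R : realType) (T : Type) (U : set_system T) (f : T -> R)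
    (a b : R) : UltraFilter U -> (forall x, a <= f x <= b) ->
  exists2 l, a <= l <= b & f x @[x --> U] --> l.
Proof.
move=> UU fab; have PU : ProperFilter U by exact: ultra_proper.
have [|l [lab lU]] := @segment_compact R a b (f x @[x --> U]) _.
  rewrite /nbhs /=; have -> : f @^-1` `[a, b] = setT; last exact: filterT.
  by apply/seteqP; split => // x _; rewrite /= in_itv /=.
exists l; first by move: lab; rewrite /= in_itv.
move=> V lV; have [//|nV] := in_ultra_setVsetC (f @^-1` V) UU.
by have [y [/= ? ?]] := lU (~` V) V nV lV.
Qed.

Lemma cvg_sumr (R : realType) (T : Type) (F : set_system T) {FF : Filter F} n
    (f : 'I_n -> T -> R) (l : 'I_n -> R) :
  (forall i, f i x @[x --> F] --> l i) ->
  \sum_i f i x @[x --> F] --> \sum_i l i.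
Proof. by move=> H; apply: cvg_big => //; exact: add_continuous. Qed.

(** This is [ln y <= y - 1] at [y = b / a], multiplied by [a ^+ 2]; for [a = 0] both sides are 0. *)
Lemma mul_ln_div_le (R : realType) (a b : R) : 0 <= a -> 0 < b ->
  a ^+ 2 * ln (b / a) <= a * b - a ^+ 2.
Proof.
rewrite le_eqVlt => /orP[/eqP <- _|a0 b0]; first by rewrite expr0n !mul0r subrr.
have : ln (b / a) <= b / a - 1.
  have := @le_ln1Dx R (b / a - 1); rewrite (addrC 1) subrK; apply.
  by rewrite ltrBrDr addNr divr_gt0.
move=> /(ler_wpM2l (sqr_ge0 a)) /le_trans; apply.
by rewrite mulrBr mulr1 expr2 -mulrA [a * (b / a)]mulrC divfK ?gt_eqF.
Qed.

(** * Convergence of the moduli under a diagonal scaling flow *)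

Section ScalingFlow.
Variables (R : realType) (d : nat) (m0 : 'I_d -> 'I_d -> R).
Variables (x : 'I_d -> R -> R) (s : R -> R).
Hypothesis m0_ge0 : forall i j, 0 <= m0 i j.
Let m i j t := expR (x j t - x i t + s t) * m0 i j.
Let B t := \sum_i (\sum_j (m i j t ^+ 2 - m j i t ^+ 2)) ^+ 2.
Hypothesis m_unit : forall t : R, 0 <= t -> \sum_i \sum_j m i j t ^+ 2 = 1.
Hypothesis s_cont : continuous s.
Hypothesis s_derive : forall t : R, 0 < t -> is_derive t (1 : R) s (4 * B t).
Variable K : R.
Hypothesis s_bounded : forall t : R, 0 <= t -> s t <= K.

Let B_ge0 t : 0 <= B t.
Proof. by apply: sumr_ge0 => i _; exact: sqr_ge0. Qed.

Let s_nondecr (a b : R) : 0 <= a -> a <= b -> s a <= s b.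
Proof.
move=> a0 ab; have [c _ E] := MVT_nneg a0 ab s_cont s_derive.
by rewrite -subr_ge0 E !mulr_ge0 // subr_ge0.
Qed.

(** Otherwise [s] would grow at rate at least [4 * e] forever, against its bound [K]. *)
Let B_small (e : R) : 0 < e -> exists2 t : R, 0 <= t & B t < e.
Proof.
move=> e0; apply: contrapT => H.
have Be (t : R) : 0 <= t -> e <= B t.
  by move=> t0; rewrite leNgt; apply/negP => Bt; apply: H; exists t.
have K0 : 0 <= K - s 0 + 1 by rewrite addr_ge0 // subr_ge0 s_bounded.
(* [T] makes the guaranteed growth [4 * e * T] exceed the available room [K - s 0] by 1. *)
pose T := (K - s 0 + 1) / (4 * e).
have e4 : 0 < 4 * e by rewrite mulr_gt0.
have T0 : 0 <= T by rewrite divr_ge0 // ltW.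
have [c c0 E] := MVT_nneg (lexx 0) T0 s_cont s_derive.
have : 4 * e * T <= s T - s 0.
  by rewrite E subr0 ler_wpM2r // ler_wpM2l // Be.
rewrite /T mulrC divfK ?gt_eqF // lerBrDr => H1.
have := s_bounded T0; rewrite /T => H2.
by have := le_trans H1 H2; rewrite addrAC subrK gerDl ler10.
Qed.

Let m_ge0 i j t : 0 <= m i j t.
Proof. by rewrite mulr_ge0 ?expR_ge0. Qed.

Let m_le1 i j (t : R) : 0 <= t -> m i j t <= 1.
Proof.
move=> t0; rewrite -(@ler_pXn2r _ 2) ?nnegrE // expr1n -(m_unit t0).
rewrite (bigD1 i) //= (bigD1 j) //= -addrA lerDl addr_ge0 //.
  by apply: sumr_ge0 => ? _; exact: sqr_ge0.
by do 2 (apply: sumr_ge0 => ? _); exact: sqr_ge0.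
Qed.

(* Balance of [p] makes [\sum p_ij^2 (x_j - x_i)] vanish. *)
Let balanced_mean (p : 'I_d -> 'I_d -> R) t : \sum_i \sum_j p i j ^+ 2 = 1 ->
  (forall i, \sum_j (p i j ^+ 2 - p j i ^+ 2) = 0) ->
  \sum_i \sum_j p i j ^+ 2 * (x j t - x i t + s t) = s t.
Proof.
move=> p1 pb.
have := sum_sub_swap (x ^~ t) (fun i j => p i j ^+ 2).
rewrite [RHS]big1 => [E|i _]; last by rewrite pb mulr0.
transitivity (\sum_i \sum_j p i j ^+ 2 * s t -
    \sum_i \sum_j (x i t - x j t) * p i j ^+ 2).
  rewrite -sumrB; apply: eq_bigr => i _; rewrite -sumrB.
  by apply: eq_bigr => j _; ring.
rewrite E subr0 -[RHS]mul1r -p1 mulr_suml.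
by apply: eq_bigr => i _; rewrite mulr_suml.
Qed.

Lemma scaling_flow_cvg : exists p : 'I_d -> 'I_d -> R,
  [/\ forall i j, 0 <= p i j,
      \sum_i \sum_j p i j ^+ 2 = 1,
      forall i j, m0 i j = 0 -> p i j = 0,
      forall i, \sum_j (p i j ^+ 2 - p j i ^+ 2) = 0 &
      \sum_i \sum_j (m i j t - p i j) ^+ 2 @[t --> +oo] --> (0 : R)].
Proof.
have /choice[u uP] : forall n : nat, exists t : R, 0 <= t /\ B t < n.+1%:R^-1.
  by move=> n; have [|t t0 Bt] := B_small (e := n.+1%:R^-1) _; last by exists t.
(* A single ultrafilter finer than [\oo] provides the limits of all entries at once. *)
have [U [UU leU]] := @ultraFilterLemma nat \oo _.
have /choice[p' p'P] : forall ij : 'I_d * 'I_d, exists l : R,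
    0 <= l /\ m ij.1 ij.2 (u n) @[n --> U] --> l.
  move=> [i j]; have [n|l /andP[l0 _] lU] := @ultra_cvg_itv R nat U
    (fun n => m i j (u n)) 0 1 UU; last by exists l.
  by rewrite m_ge0 m_le1 //; exact: (uP n).1.
pose p i j := p' (i, j).
have p0 i j : 0 <= p i j by exact: (p'P (i, j)).1.
have pU i j : m i j (u n) @[n --> U] --> p i j by exact: (p'P (i, j)).2.
have p2U i j : m i j (u n) ^+ 2 @[n --> U] --> p i j ^+ 2.
  by rewrite expr2; under eq_fun do rewrite expr2; apply: cvgM.
have p1 : \sum_i \sum_j p i j ^+ 2 = 1.
  apply: (@cvg_unique R _ (\sum_i \sum_j m i j (u n) ^+ 2 @[n --> U])) => //.
    by do 2 (apply: cvg_sumr => ?).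
  have -> : (fun n => \sum_i \sum_j m i j (u n) ^+ 2) = cst 1.
    by apply/funext => n; exact: m_unit (uP n).1.
  exact: cvg_cst.
have pz i j : m0 i j = 0 -> p i j = 0.
  move=> z; suff H : m i j (u n) @[n --> U] --> (0 : R) by exact: cvg_unique _ (pU i j) H.
  have -> : (fun n => m i j (u n)) = cst 0 by apply/funext => n; rewrite /m z mulr0.
  exact: cvg_cst.
have BU : B (u n) @[n --> U] --> (0 : R).
  suff : B (u n) @[n --> \oo] --> (0 : R) by move=> H V /H; exact: leU.
  apply: (@squeeze_cvgr _ _ _ _ (cst 0) harmonic); [|exact: cvg_cst|exact: cvg_harmonic].
  by near=> n; rewrite B_ge0 /= ltW // (uP n).2.
have pb i : \sum_j (p i j ^+ 2 - p j i ^+ 2) = 0.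
  have BU' : B (u n) @[n --> U] --> \sum_i (\sum_j (p i j ^+ 2 - p j i ^+ 2)) ^+ 2.
    rewrite /B; apply: cvg_sumr => k; rewrite expr2; under eq_fun do rewrite expr2.
    by apply: cvgM; apply: cvg_sumr => j; apply: cvgB.
  have B0 : \sum_i (\sum_j (p i j ^+ 2 - p j i ^+ 2)) ^+ 2 = 0.
    exact: cvg_unique _ BU' BU.
  apply/eqP; rewrite -sqrf_eq0; apply/eqP; move: i {BU'} isT.
  by apply: psumr_eq0P B0 => k _; exact: sqr_ge0.
exists p; split => //.
(* The relative entropy to [p] at time [t] is [C - s t]. Where [p i j = 0] the factor [p i j ^+ 2]
   cancels the term, whatever the logarithm. *)
pose C := \sum_i \sum_j p i j ^+ 2 * ln (p i j / m0 i j).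
have m0_gt0 i j : 0 < p i j -> 0 < m0 i j.
  move=> pij; rewrite lt_def m0_ge0 andbT.
  by apply: contraTN pij => /eqP /pz ->; rewrite ltxx.
have m_gt0 i j t : 0 < p i j -> 0 < m i j t.
  by move=> /m0_gt0 ?; rewrite mulr_gt0 ?expR_gt0.
have p_eq i j : p i j = 0 \/ 0 < p i j.
  by move: (p0 i j); rewrite le_eqVlt => /orP[/eqP|]; [left|right].
have key (t : R) : 0 <= t -> \sum_i \sum_j (m i j t - p i j) ^+ 2 <= 2 * (C - s t).
  move=> t0; rewrite -(balanced_mean t p1 pb).
  (* As [m] and [p] both have squared norm 1, the squared distance becomes linear in [m], and
     [mul_ln_div_le] then applies term by term. *)
  have -> : \sum_i \sum_j (m i j t - p i j) ^+ 2 =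
      \sum_i \sum_j 2 * (p i j ^+ 2 - p i j * m i j t).
    have <- : \sum_i \sum_j m i j t ^+ 2 - \sum_i \sum_j p i j ^+ 2 +
        \sum_i \sum_j 2 * (p i j ^+ 2 - p i j * m i j t) =
        \sum_i \sum_j (m i j t - p i j) ^+ 2.
      rewrite -sumrB -big_split /=; apply: eq_bigr => i _.
      by rewrite -sumrB -big_split /=; apply: eq_bigr => j _; ring.
    by rewrite m_unit // p1 subrr add0r.
  rewrite /C -sumrB mulr_sumr; apply: ler_sum => i _.
  rewrite -sumrB mulr_sumr; apply: ler_sum => j _; rewrite ler_wpM2l //.
  have [->|pij] := p_eq i j; first by rewrite expr0n !mul0r subrr.
  have := mul_ln_div_le (ltW pij) (m_gt0 i j t pij).
  have mij := m0_gt0 i j pij.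
  have -> : ln (m i j t / p i j) = (x j t - x i t + s t) - ln (p i j / m0 i j).
    rewrite /m -mulrA lnM ?posrE ?expR_gt0 ?divr_gt0 // expRK.
    by rewrite -lnV ?posrE ?divr_gt0 // invf_div.
  by rewrite mulrBr; lra.
(* Since [ln (m i j t / m0 i j)] is the exponent of the scaling, [balanced_mean] writes [s] as a
   weighted sum of these logarithms, which converge along [U]. *)
have sU : s (u n) @[n --> U] --> C.
  have -> : (fun n => s (u n)) =
      (fun n => \sum_i \sum_j p i j ^+ 2 * ln (m i j (u n) / m0 i j)).
    apply/funext => n; rewrite -[LHS](balanced_mean _ p1 pb).
    apply: eq_bigr => i _; apply: eq_bigr => j _.
    have [->|pij] := p_eq i j; first by rewrite expr0n !mul0r.
    by rewrite /m mulfK ?gt_eqF ?m0_gt0 // expRK.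
  apply: cvg_sumr => i; apply: cvg_sumr => j.
  have [->|pij] := p_eq i j.
    under eq_fun do rewrite expr0n mul0r; rewrite expr0n mul0r; exact: cvg_cst.
  apply: cvgM; first exact: cvg_cst.
  apply: continuous_cvg.
    by apply: continuous_ln; rewrite divr_gt0 ?m0_gt0.
  by apply: cvgM => //; exact: cvg_cst.
apply/cvgr0Pnorm_le => e e0.
(* One such index suffices: [s] is nondecreasing, so [2 * (C - s t)] stays below [e] at all later
   times. *)
have [n Hn] : exists n, C - e / 2 < s (u n).
  have e2 : 0 < e / 2 by rewrite divr_gt0.
  have /cvgrPdist_lt/(_ _ e2) /filter_ex[n] := sU.
  by rewrite ltr_distlC => /andP[H _]; exists n.
near=> t; rewrite ger0_norm; last first.
  by apply: sumr_ge0 => i _; apply: sumr_ge0 => j _; exact: sqr_ge0.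
have ut : u n <= t by near: t; exact: (nbhs_pinfty_ge (num_real _)).
have u0 := (uP n).1.
apply: le_trans (key t (le_trans u0 ut)) _.
have := s_nondecr u0 ut; lra.
Unshelve. all: by end_near. Qed.

End ScalingFlow.

(** * The gradient flow as a diagonal scaling *)

(** Each entry solves a linear equation whose coefficient [c i j] is real. With [x] and [s] built as
    primitives along the given flow, [x j - x i + s] is a primitive of [c i j], and [linear_ode]
    applies. *)
Lemma neg_grad_flow_scaling (R : realType) (d : nat)
    (Phi : 'M[R[i]]_d -> R -> 'M[R[i]]_d) (A0 : 'M[R[i]]_d) :
  is_neg_grad_flow (@unit_sphere R d) (@Bbar R d) Phi -> unit_sphere A0 ->
  exists (x : 'I_d -> R -> R) (s : R -> R), [/\ continuous s,
    forall t : R, 0 < t -> is_derive t (1 : R) s (4 * Bbar (Phi A0 t)) &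
    forall (t : R) i j, 0 <= t ->
      Phi A0 t i j = (expR (x j t - x i t + s t))%:C * A0 i j].
Proof.
move=> flow S0; have [P0 PS PG] := flow A0 S0.
pose a t := Phi A0 t.
pose c i j t := 4 * (defect (a t) j - defect (a t) i + Bbar (a t)).
have vel (t : R) : 0 <= t -> velocity_within [set s | 0 <= s] a t (- sphere_grad (a t)).
  move=> t0; have [G GG VG] := PG t t0.
  by rewrite -(riemannian_grad_BbarE (PS t t0) GG).
have cE i j t : (- sphere_grad (a t)) i j = (c i j t)%:C * a t i j.
  have -> : c i j t = - (4 * (defect (a t) i - defect (a t) j - Bbar (a t))).
    by rewrite /c; ring.
  by rewrite !mxE rmorphN mulNr.
have dRe i j (t : R) : 0 <= t -> hquot_cvg (fun s => complex.Re (a s i j)) t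
    (c i j t * complex.Re (a t i j)).
  move=> /vel /velocity_hquot_Re - /(_ i j).
  by rewrite cE ReZ.
have dIm i j (t : R) : 0 <= t -> hquot_cvg (fun s => complex.Im (a s i j)) t
    (c i j t * complex.Im (a t i j)).
  move=> /vel /velocity_hquot_Im - /(_ i j).
  by rewrite cE ImZ.
have cRe i j := hquot_continuous (dRe i j).
have cIm i j := hquot_continuous (dIm i j).
have cN i j : continuous (fun t : R => ComplexField.Normc.normc (a `|t| i j) ^+ 2).
  under eq_fun do rewrite sqr_normcE !expr2.
  by move=> t; apply: cvgD; apply: cvgM; [exact: cRe|exact: cRe|exact: cIm|exact: cIm].
have cD i : continuous (fun t : R => defect (a `|t|) i).
  by move=> t; apply: cvg_sumr => j; apply: cvgB; exact: cN.
have cB : continuous (fun t : R => Bbar (a `|t|)).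
  under eq_fun do rewrite Bbar_defect.
  by move=> t; apply: cvg_sumr => i; under eq_fun do rewrite expr2; apply: cvgM; exact: cD.
have /choice[x xP] : forall i, exists F : R -> R, [/\ F 0 = 0, continuous F &
    forall t : R, 0 < t -> is_derive t (1 : R) F (4 * defect (a `|t|) i)].
  by move=> i; apply: primitive_nneg => t; apply: cvgM; [exact: cvg_cst|exact: cD].
have [s [s0 sc sd]] : exists F : R -> R, [/\ F 0 = 0, continuous F &
    forall t : R, 0 < t -> is_derive t (1 : R) F (4 * Bbar (a `|t|))].
  by apply: primitive_nneg => t; apply: cvgM; [exact: cvg_cst|exact: cB].
exists x, s; split=> [|t t0|t i j t0]; first exact: sc.
  by have := sd t t0; rewrite gtr0_norm.
pose C := x j - x i + s.
have cC : continuous C.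
  move=> r; apply: cvgD; last exact: sc.
  by apply: cvgB; [have [_ + _] := xP j|have [_ + _] := xP i]; apply.
have dC (r : R) : 0 < r -> is_derive r (1 : R) C (c i j `|r|).
  move=> r0; have [_ _ /(_ r r0) ?] := xP j; have [_ _ /(_ r r0) ?] := xP i.
  have ? := sd r r0; by apply: is_derive_eq; rewrite /c; ring.
have C0 : C 0 = 0.
  have [xj _ _] := xP j; have [xi _ _] := xP i.
  by rewrite /C !fctE xj xi s0 subrr addr0.
(* Used for [f] the real part and then the imaginary part, which obey the same equation. *)
have main (f : R[i] -> R) : (forall r : R, 0 <= r ->
      hquot_cvg (fun s => f (a s i j)) r (c i j r * f (a r i j))) ->
    f (a t i j) = f (A0 i j) * expR (C t).
  move=> df; have := linear_ode (hquot_continuous df) (c := fun r => c i j `|r|) _ cC dC t0.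
  rewrite normr0 C0 subr0 ger0_norm // /a P0; apply=> r r0.
  by have := hquot_derive r0 (df r (ltW r0)); rewrite gtr0_norm.
apply/eqP; rewrite eq_complex; have -> : x j t - x i t + s t = C t by [].
rewrite ReZ ImZ -/(a t); apply/andP; split; apply/eqP.
  by rewrite (main _ (dRe i j)) mulrC.
by rewrite (main _ (dIm i j)) mulrC.
Qed.

(** * The limit matrix, rebuilt from the limit of the moduli *)

Theorem theorem4p5 (R : realType) (d : nat) (hd : (1 <= d)%N)
    (Phi : 'M[R[i]]_d -> R -> 'M[R[i]]_d)
    (hPhi : is_neg_grad_flow (@unit_sphere R d) (@Bbar R d) Phi)
    (A0 : 'M[R[i]]_d) (hA0 : unit_sphere A0) (hnil : ~ nilpotent_mx A0) :
  exists Ainf : 'M[R[i]]_d,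
    mx_cvg (Phi A0) +oo Ainf /\
    balanced Ainf /\
    frob Ainf = 1 /\
    (forall i j, A0 i j = 0 -> Ainf i j = 0) /\
    (A0 \is a mxOver Num.real -> Ainf \is a mxOver Num.real) /\
    (A0 \is a mxOver Num.nneg -> Ainf \is a mxOver Num.nneg).
Proof.
have [x [s [s_cont s_derive aE]]] := neg_grad_flow_scaling hPhi hA0.
have [_ PS _] := hPhi A0 hA0.
pose m0 i j := ComplexField.Normc.normc (A0 i j).
have m0_ge0 i j : 0 <= m0 i j by exact: normc_ge0.
have mE (t : R) i j : 0 <= t ->
    ComplexField.Normc.normc (Phi A0 t i j) = expR (x j t - x i t + s t) * m0 i j.
  by move=> t0; rewrite aE // ComplexField.Normc.normcM normcR ger0_norm ?expR_ge0.
have m_unit (t : R) : 0 <= t ->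
    \sum_i \sum_j (expR (x j t - x i t + s t) * m0 i j) ^+ 2 = 1.
  move=> t0; rewrite -[RHS](expr1n _ 2) -(PS t t0) sqr_frob.
  by apply: eq_bigr => i _; apply: eq_bigr => j _; rewrite mE.
have [K HK] := scaling_bound hd hnil.
have s_bounded (t : R) : 0 <= t -> s t <= K.
  move=> t0; apply: (HK (x ^~ t)) => i j; rewrite -aE // -(PS t t0).
  exact: normc_le_frob.
have [|p [p_ge0 p_unit p_supp p_bal p_cvg]] :=
    @scaling_flow_cvg R d m0 x s m0_ge0 m_unit s_cont _ K s_bounded.
  move=> t t0; have := s_derive t t0; rewrite Bbar_defect.
  suff -> : \sum_i defect (Phi A0 t) i ^+ 2 = \sum_i (\sum_j
      ((expR (x j t - x i t + s t) * m0 i j) ^+ 2 -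
       (expR (x i t - x j t + s t) * m0 j i) ^+ 2)) ^+ 2 by [].
  apply: eq_bigr => i _; congr (_ ^+ 2); apply: eq_bigr => j _.
  by rewrite !mE // ltW.
(* The entry has modulus [p i j] and the phase of [A0 i j]. Where [m0 i j = 0], the quotient is 0 by
   convention and [A0 i j] is 0 as well. The nonnegative real factor yields the claims on zeros,
   reality and signs. *)
pose Ainf := \matrix_(i, j) ((p i j / m0 i j)%:C * A0 i j).
have pE i j : p i j / m0 i j * m0 i j = p i j.
  have [/eqP|] := boolP (m0 i j == 0); last by move=> ?; rewrite divfK.
  by move=> z; rewrite z mulr0 p_supp.
have NA i j : ComplexField.Normc.normc (Ainf i j) = p i j.
  rewrite mxE ComplexField.Normc.normcM normcR ger0_norm ?pE //.
  by rewrite divr_ge0.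
have p_div i j : 0 <= p i j / m0 i j by rewrite divr_ge0.
exists Ainf; split; [|split; [|split; [|split; [|split]]]].
- rewrite /mx_cvg -[X in _ --> X](sqrtr0 R).
  have : Num.sqrt (\sum_i \sum_j (expR (x j t - x i t + s t) * m0 i j - p i j) ^+ 2)
      @[t --> +oo] --> Num.sqrt (0 : R).
    by apply: continuous_cvg => //; exact: sqrt_continuous.
  apply: cvg_trans; apply: near_eq_cvg; near=> t; rewrite /frob; congr Num.sqrt.
  have t0 : 0 <= t by near: t; exact: (nbhs_pinfty_ge (num_real _)).
  apply: eq_bigr => i _; apply: eq_bigr => j _.
  (* Both entries are real multiples of the same [A0 i j], so the modulus of their difference is the
     distance between their moduli. *)
  rewrite !mxE aE // -mulrBl -rmorphB ComplexField.Normc.normcM normcR exprMn.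
  by rewrite real_normK ?num_real // -exprMn mulrBl pE.
- apply/balanced_defect => i; rewrite /defect -[RHS](p_bal i).
  by apply: eq_bigr => j _; rewrite !NA.
- rewrite -[LHS]ger0_norm ?frob_ge0 // -sqrtr_sqr sqr_frob -[RHS]sqrtr1 -p_unit.
  congr Num.sqrt; apply: eq_bigr => i _; apply: eq_bigr => j _; by rewrite NA.
- by move=> i j z; rewrite mxE z mulr0.
- move=> /mxOverP A0real; apply/mxOverP => i j; rewrite mxE rpredM //.
  by apply/complex_realP; exists (p i j / m0 i j).
- move=> /mxOverP A0nneg; apply/mxOverP => i j; rewrite mxE rpredM //.
  by rewrite nnegrE ler0c.
Unshelve. all: by end_near. Qed.
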